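(* Let $\alpha\in(0,1)$ and let $(P_\theta:\theta\in\Theta)$ be an arbitrary collection of distributions having densities $p_\theta$ with respect to a common measure $\mu$. Let $Y_1,\dots,Y_{2n}$ be i.i.d. from $P_{\theta^*}$ with $\theta^*\in\Theta$, split into two groups $D_0$ and $D_1$ of size $n$. Let $\widehat\theta_1\in\Theta$ be any estimator constructed from $D_1$, and let $T_n(\theta)$ be the split likelihood ratio statistic and $S_n(\theta)$ the crossfit likelihood ratio statistic. Let $C_n$ be either $\{\theta\in\Theta: T_n(\theta)\le 1/\alpha\}$ or $\{\theta\in\Theta: S_n(\theta)\le 1/\alpha\}$. Then $C_n$ is a finite-sample valid $(1-\alpha)$ confidence set for $\theta^*$, i.e. $$P_{\theta^*}(\theta^*\in C_n)\ \ge\ 1-\alpha .$$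
   Context: The split into $D_0,D_1$ is a partition of the data indices chosen independently of the data. The likelihood on $D_0$ is $\mathcal L_0(\theta)=\prod_{i\in D_0}p_\theta(Y_i)$. The split likelihood ratio statistic is $T_n(\theta)=\mathcal L_0(\widehat\theta_1)/\mathcal L_0(\theta)$. The crossfit statistic is $S_n(\theta)=(T_n(\theta)+T_n^{\mathrm{swap}}(\theta))/2$, where $T_n^{\mathrm{swap}}(\theta)$ is $T_n(\theta)$ computed after swapping the roles of $D_0$ and $D_1$ (the estimator is constructed from $D_0$ and the likelihood ratio is evaluated on $D_1$). All quantities are assumed measurable as needed; note that $\mathcal L_0(\theta^* )>0$ almost surely under $P_{\theta^*}$. *)

(* Defs.v *)
From HB Require Import structures.
From mathcomp Require Import all_boot all_order all_algebra.
From mathcomp Require Import all_classical all_reals all_analysis.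

Set Implicit Arguments.
Unset Strict Implicit.
Unset Printing Implicit Defensive.

Import Order.TTheory GRing.Theory Num.Theory.

Local Open Scope classical_set_scope.
Local Open Scope ring_scope.

Definition is_density d (T : measurableType d) (R : realType)
    (mu : {measure set T -> \bar R}) (Q : probability T R) (f : T -> R) : Prop :=
  [/\ measurable_fun setT f, (forall x, 0 <= f x) &
      forall A, measurable A -> Q A = (\int[mu]_(x in A) (f x)%:E)%E].

Definition mutually_independent dO (Omega : measurableType dO) (R : realType)
    (P : probability Omega R) d (T : measurableType d) (N : nat)
    (Y : 'I_N -> {RV P >-> T}) : Prop :=
  forall (J : {set 'I_N}) (A : 'I_N -> set T),
    (forall i, measurable (A i)) ->
    P (\bigcap_(i in [set` J]) (Y i @^-1` A i)) =
    (\prod_(i in J) P (Y i @^-1` A i))%E.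

Definition iid_from dO (Omega : measurableType dO) (R : realType)
    (P : probability Omega R) d (T : measurableType d) (Q : probability T R)
    (N : nat) (Y : 'I_N -> {RV P >-> T}) : Prop :=
  mutually_independent Y /\
  forall i A, measurable A -> distribution P (Y i) A = Q A.

Definition sample dO (Omega : measurableType dO) (R : realType)
    (P : probability Omega R) d (T : measurableType d) (N : nat)
    (Y : 'I_N -> {RV P >-> T}) (w : Omega) : N.-tuple T :=
  [tuple Y i w | i < N].

(* The split is recorded by the index set D0; D1 is its complement. D0 may be
   random; a deterministic split is the case of a constant function. *)
Definition independent_half_split dO (Omega : measurableType dO) (R : realType)
    (P : probability Omega R) d (T : measurableType d) (n : nat)
    (Y : 'I_(2 * n) -> {RV P >-> T}) (D0 : Omega -> {set 'I_(2 * n)}) : Prop :=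
  [/\ (forall w, #|D0 w| = n),
      (forall D, measurable (D0 @^-1` [set D])) &
      forall (D : {set 'I_(2 * n)}) (B : set ((2 * n).-tuple T)), measurable B ->
        P (D0 @^-1` [set D] `&` sample Y @^-1` B) =
        (P (D0 @^-1` [set D]) * P (sample Y @^-1` B))%E].

(* [e] is a function of the observations indexed by [D] alone. *)
Definition constructed_from (T Theta : Type) (N : nat) (D : {set 'I_N})
    (e : N.-tuple T -> Theta) : Prop :=
  forall y y' : N.-tuple T,
    (forall i, i \in D -> tnth y i = tnth y' i) -> e y = e y'.

Section Statistics.
Variables (T Theta : Type) (R : realType) (p : Theta -> T -> R) (N : nat).
Implicit Types (D : {set 'I_N}) (y : N.-tuple T) (theta : Theta).

Definition likelihood D y theta : R := \prod_(i in D) p theta (tnth y i).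

(* The estimation procedure: [est D y] is the estimate constructed from the
   observations of the sample [y] with index in [D]. *)
Variable est : {set 'I_N} -> N.-tuple T -> Theta.

(* The ratio is extended-real: it is +oo when only the denominator vanishes,
   and 0 when both numerator and denominator vanish. *)
Definition split_LR D y theta : \bar R :=
  ((likelihood D y (est (~: D) y))%:E / (likelihood D y theta)%:E)%E.

Definition crossfit_LR D y theta : \bar R :=
  ((split_LR D y theta + split_LR (~: D) y theta) / 2%:E)%E.

Definition split_set (alpha : R) D y : set Theta :=
  [set theta | (split_LR D y theta <= (1 / alpha)%:E)%E].

Definition crossfit_set (alpha : R) D y : set Theta :=
  [set theta | (crossfit_LR D y theta <= (1 / alpha)%:E)%E].

End Statistics.

(* Main.v *)
(* Let Q be the true law and r_theta = p_theta / p_theta*, so that r_theta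
   integrates to at most 1 under Q. Almost surely the denominator of the split
   ratio is positive, and the ratio is then the product over i in D0 of
   r_(theta1)(Y_i), where theta1 depends on the coordinates in D1 only.
   Integrating out the coordinates in D0 one at a time, each by resampling it
   from Q, shows that the split ratio has expectation at most 1; averaging, so
   does the crossfit ratio. Markov's inequality bounds the coverage for each
   fixed split, and one sums over the values of the independent random split. *)
Require Import Defs.
From HB Require Import structures.
From mathcomp Require Import all_boot all_order all_algebra.
From mathcomp Require Import all_classical all_reals all_analysis.
From mathcomp Require Import measurable_realfun.

Import Order.TTheory GRing.Theory Num.Theory.

Local Open Scope classical_set_scope.
Local Open Scope ring_scope.

(** * Integration against a law given by its density *)

Section Density.
Context {d} {T : measurableType d} {R : realType}.
Variables (mu : {measure set T -> \bar R}) (Q : probability T R) (p : T -> R).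
Hypothesis hp : is_density mu Q p.

Import HBNNSimple.

Lemma is_density_integral_indic (A : set T) : measurable A ->
  (\int[Q]_x (\1_A x)%:E = \int[mu]_x ((\1_A x)%:E * (p x)%:E))%E.
Proof.
move=> mA; have [mp p0 QE] := hp.
rewrite integral_indic// setIT [LHS]QE//.
rewrite (integral_mkcond A); apply: eq_integral => x _.
by rewrite epatch_indic muleC.
Qed.

Lemma is_density_integral_nnsfun (h : {nnsfun T >-> R}) :
  (\int[Q]_x (h x)%:E = \int[mu]_x ((h x)%:E * (p x)%:E))%E.
Proof.
have [mp p0 QE] := hp.
have mi r : measurable_fun setT (fun x => (r * \1_(h @^-1` [set r]) x)%:E).
  by apply/measurable_EFinP; exact: measurable_funM.
transitivity (\int[Q]_x
   (\sum_(y \in range h) (y * \1_(h @^-1` [set y]) x)%:E))%E.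
  by apply: eq_integral => t _; rewrite /= fimfunE -fsumEFin.
rewrite ge0_integral_fsum//; last by move=> m y _; exact: nnfun_muleindic_ge0.
transitivity (\int[mu]_x (\sum_(y \in range h)
    (y * \1_(h @^-1` [set y]) x)%:E * (p x)%:E))%E; last first.
  apply: eq_integral => x _.
  rewrite -ge0_mule_fsuml => [|y]; last exact: nnfun_muleindic_ge0.
  by rewrite fsumEFin // -(fimfunE _ x).
rewrite ge0_integral_fsum//; last 2 first.
  - by move=> y; apply: emeasurable_funM => //; exact/measurable_EFinP.
  - by move=> m y _; rewrite mule_ge0 ?nnfun_muleindic_ge0 ?lee_fin ?p0.
apply: eq_fsbigr => r /[!inE] -[t _ rE].
have r0 : 0 <= r by rewrite -rE.
under eq_integral do rewrite EFinM.
under [RHS]eq_integral do rewrite EFinM -muleA.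
rewrite !ge0_integralZl_EFin//.
- by rewrite is_density_integral_indic.
- by move=> x _; rewrite mule_ge0 ?lee_fin// p0.
- by apply: emeasurable_funM => //; exact/measurable_EFinP.
- by apply/measurable_EFinP.
Qed.

(** Linearity gives the formula for simple functions, and monotone convergence along
    [nnsfun_approx], applied on both sides, carries it to every nonnegative measurable [f]. *)
Lemma is_density_integral (f : T -> \bar R) : measurable_fun setT f ->
    (forall x, 0 <= f x)%E ->
  (\int[Q]_x f x = \int[mu]_x (f x * (p x)%:E))%E.
Proof.
move=> mf f0; have [mp p0 _] := hp.
pose h := nnsfun_approx measurableT mf.
transitivity (limn (fun n => \int[Q]_x (EFin \o h n) x))%E.
  rewrite -monotone_convergence//.
  - apply: eq_integral => x _; apply/esym/cvg_lim => //.
    exact: cvg_nnsfun_approx.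
  - by move=> n; exact/measurable_EFinP.
  - by move=> n x _; rewrite lee_fin.
  - by move=> x _ a b ab; rewrite lee_fin; exact/lefP/nd_nnsfun_approx.
under eq_fun do rewrite is_density_integral_nnsfun.
rewrite -monotone_convergence//.
- apply: eq_integral => x _; apply/cvg_lim => //; apply: cvgeZr => //.
  exact: cvg_nnsfun_approx.
- by move=> n; apply: emeasurable_funM; exact/measurable_EFinP.
- by move=> n x _; rewrite mule_ge0 ?lee_fin.
- move=> x _ a b ab; rewrite lee_wpmul2r ?lee_fin//.
  exact/lefP/nd_nnsfun_approx.
Qed.

(** The source of the almost sure positivity of the denominator: the density integrates to zero over
    its own zero set. *)
Lemma is_density_eq0 : Q (p @^-1` [set 0]) = 0%E.
Proof.
have [mp p0 QE] := hp.
have m0 : measurable (p @^-1` [set 0]).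
  by rewrite -[X in measurable X]setTI; exact: mp (measurable_set1 0).
by rewrite QE//; apply: integral0_eq => x /= ->.
Qed.

End Density.

Lemma measurable_funV {d} {T : measurableType d} {R : realType} (f : T -> R) :
  (forall x, 0 <= f x) ->
  measurable_fun setT f -> measurable_fun setT (fun x => (f x)^-1).
Proof.
(* On nonnegative reals inversion is the power with exponent -1, including at 0, where both are 0 by
   convention. *)
move=> f0 mf; under eq_fun do rewrite -powR_inv1//.
exact: measurableT_comp (measurable_powR _) mf.
Qed.

(* Only [<=]: the part of [Q'] carried by the zeros of [p] is lost. *)
Lemma integral_density_ratio_le1 {d} {T : measurableType d} {R : realType}
    (mu : {measure set T -> \bar R}) (Q Q' : probability T R) (p p' : T -> R) :
  is_density mu Q p -> is_density mu Q' p' ->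
  (\int[Q]_x (p' x / p x)%:E <= 1)%E.
Proof.
move=> hp hp'; have [mp p0 _] := hp; have [mp' p'0 Q'E] := hp'.
have mr : measurable_fun setT (fun x => (p' x / p x)%:E).
  by apply/measurable_EFinP/measurable_funM => //; exact: measurable_funV.
rewrite (is_density_integral _ _ _ hp)//; last by move=> x; rewrite lee_fin divr_ge0.
(* The bound 1 is rewritten as the total mass of [Q'], the integral of [p'], so that a pointwise
   comparison of the integrands suffices. *)
rewrite -(probability_setT Q') Q'E//; apply: ge0_le_integral => //.
- by move=> x _; rewrite -EFinM lee_fin !mulr_ge0// invr_ge0.
- by apply: emeasurable_funM => //; exact/measurable_EFinP.
- exact/measurable_EFinP.
- move=> x _; rewrite -EFinM lee_fin.
  have [->|px] := eqVneq (p x) 0; first by rewrite mulr0.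
  by rewrite divfK.
Qed.

(** * Product laws on tuples and resampling of one coordinate *)

Definition box {T : Type} {N : nat} (A : 'I_N -> set T) : set (N.-tuple T) :=
  [set y | forall j, A j (tnth y j)].

Definition resample {T : Type} {N : nat} (i : 'I_N) (y : N.-tuple T) (t : T) :
    N.-tuple T := [tuple if j == i then t else tnth y j | j < N].

Section Box.
Context {d} {T : measurableType d} {R : realType} {N : nat}.

Lemma measurable_box (A : 'I_N -> set T) : (forall j, measurable (A j)) ->
  measurable (box A).
Proof.
move=> mA; rewrite (_ : box A =
  \bigcap_(j in [set: 'I_N]) ((@tnth N T)^~ j @^-1` A j)).
  apply: fin_bigcap_measurable => // j _; rewrite -[X in measurable X]setTI.
  exact: measurable_tnth.
by apply/seteqP; split => [y Ay j _|y Ay j]; exact: Ay.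
Qed.

(** Boxes are stable under intersection and generate the sigma-algebra of tuples, so uniqueness of
    measures on a pi-system applies. *)
Lemma box_measure_unique (m1 m2 : probability (N.-tuple T) R) :
  (forall A, (forall j, measurable (A j)) -> m1 (box A) = m2 (box A)) ->
  forall B, measurable B -> m1 B = m2 B.
Proof.
move=> m12 B mB.
pose G := [set C | exists2 A : 'I_N -> set T,
  (forall j, measurable (A j)) & C = box A].
have GT : G setT.
  by exists (fun=> setT) => //; apply/seteqP; split.
apply: (@g_sigma_algebra_measure_unique _ _ _ G _ (fun=> setT)) => //.
- by move=> _ [A mA ->]; exact: measurable_box.
- by rewrite bigcup_const//; exists 0%N.
- move=> _ _ [A mA ->] [A' mA' ->]; exists (fun j => A j `&` A' j).
    by move=> j; exact: measurableI.
  apply/seteqP; split => [y [Ay A'y] j|y AAy]; first by split.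
  by split=> j; case: (AAy j).
- by move=> _ [A mA ->]; exact: m12.
- by move=> _; rewrite [ltLHS]probability_setT ltry.
(* A generator constrains a single coordinate, so it is a box whose other sides are full. *)
- move: B mB; apply: smallest_sub; first exact: smallest_sigma_algebra.
  move=> C; rewrite -bigcup_seq/= => -[i _ [A mA <-]].
  apply: sub_sigma_algebra; exists (fun j => if j == i then A else setT).
    by move=> j; case: ifP.
  apply/seteqP; split => [y [_ /= Ay] j|y /(_ i)]; last by rewrite eqxx.
  by case: eqP => // ->.
Qed.

Variables (L : probability (N.-tuple T) R) (Q : probability T R).
Hypothesis LE : forall A, (forall j, measurable (A j)) ->
  L (box A) = (\prod_j Q (A j))%E.

Lemma measurable_resample i :
  measurable_fun setT (fun z : N.-tuple T * T => resample i z.1 z.2).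
Proof.
apply/measurable_fun_tnthP => j.
rewrite (_ : _ \o _ = if j == i then snd else (fun y => tnth y j) \o fst).
  by case: ifP => // _; exact: measurableT_comp (measurable_tnth j) _.
by apply/funext => z; rewrite /= tnth_mktuple; case: ifP.
Qed.

(** If [y] has law [L] and [t] is an independent draw from [Q], then [resample i y t] again has law
    [L], as is seen on boxes; Tonelli's theorem turns this into an iterated integral. *)
Lemma integral_resample i (F : N.-tuple T -> \bar R) : measurable_fun setT F ->
    (forall y, 0 <= F y)%E ->
  (\int[L]_y F y = \int[L]_y \int[Q]_t F (resample i y t))%E.
Proof.
move=> mF F0; pose phi (z : N.-tuple T * T) := resample i z.1 z.2.
have mphi : measurable_fun setT phi := measurable_resample i.
pose phim : {mfun (N.-tuple T * T)%type >-> N.-tuple T} :=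
  HB.pack phi (isMeasurableFun.Build _ _ _ _ _ mphi).
have E : forall B, measurable B -> L B = distribution (L \x Q)%E phim B.
  apply: box_measure_unique => A mA.
  rewrite /distribution/= /pushforward.
  (* The side [A i] becomes a constraint on the fresh draw, and the corresponding side for [y]
     becomes full, of mass 1. *)
  rewrite (_ : _ @^-1` _ =
      box (fun j => if j == i then setT else A j) `*` A i); last first.
    apply/seteqP; split => [[y t] /= Ayt|[y t] /= [Ay At] j].
      split=> [j|]; last by have := Ayt i; rewrite tnth_mktuple eqxx.
      by case: ifP => // ji; have := Ayt j; rewrite tnth_mktuple ji.
    rewrite tnth_mktuple; case: ifPn => [/eqP -> //|ji].
    by have := Ay j; rewrite (negbTE ji).
  have mA' j : measurable (if j == i then setT else A j) by case: ifP.
  rewrite product_measure1E//; last exact: measurable_box.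
  rewrite [X in (X * _)%E]LE// LE// (bigD1 i)//= [in RHS](bigD1 i)//= eqxx.
  rewrite probability_setT mul1e.
  rewrite muleC; congr (_ * _)%E; apply: eq_bigr => j ji.
  by rewrite (negbTE ji).
rewrite (eq_measure_integral (distribution (L \x Q)%E phim)); last first.
  by move=> B mB _; exact: E.
rewrite ge0_integral_distribution// fubini_tonelli1//.
  exact: measurableT_comp.
by move=> z; exact: F0.
Qed.

(** Induction on the coordinates still to be integrated out. The factor [c] collects the integrals
    already performed; like [r], it depends only on coordinates outside [s]. Measurability in [y] is
    asked of [F] as a whole, since [r] will hide an arbitrary estimator. *)
Lemma integral_prod_le1 (s : seq 'I_N) (F c : N.-tuple T -> \bar R)
    (r : N.-tuple T -> T -> R) :
  uniq s -> measurable_fun setT F ->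
  (forall y, 0 <= c y <= 1)%E ->
  (forall y y', (forall i, i \notin s -> tnth y i = tnth y' i) ->
    c y = c y' /\ r y = r y') ->
  (forall y t, 0 <= r y t) -> (forall y, measurable_fun setT (r y)) ->
  (forall y, \int[Q]_t (r y t)%:E <= 1)%E ->
  (forall y, F y = c y * (\prod_(i <- s) r y (tnth y i))%:E)%E ->
  (\int[L]_y F y <= 1)%E.
Proof.
elim: s F c => [|i s IH] F c /=.
  move=> _ mF c01 _ _ _ _ FE.
  have Fc y : F y = c y by rewrite FE big_nil mule1.
  rewrite -(probability_setT L) -[leRHS]mul1e -integral_cst//.
  apply: ge0_le_integral => //.
  - by move=> y _; rewrite Fc; case/andP: (c01 y).
  - by move=> y _; rewrite Fc; case/andP: (c01 y).
move=> /andP[iNs us] mF c01 cr r0 mr r1 FE.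
have c0 y : (0 <= c y)%E by case/andP: (c01 y).
have F0 y : (0 <= F y)%E.
  by rewrite FE mule_ge0// lee_fin prodr_ge0.
have mFi : measurable_fun setT (fun y => \int[Q]_t F (resample i y t))%E.
  apply: (@measurable_fun_fubini_tonelli_F _ _ _ _ _ Q
    (fun z => F (resample i z.1 z.2))) => //.
  exact: measurableT_comp (measurable_resample i).
rewrite (integral_resample i)//.
(* Integrating out coordinate [i] leaves the integral of [r y] under [Q], a factor at most 1, which
   is absorbed into [c]. *)
apply: (IH _ (fun y => c y * \int[Q]_t (r y t)%:E)%E) => //.
- move=> y; rewrite mule_ge0 ?integral_ge0//=; last first.
    by move=> t _; rewrite lee_fin.
  case/andP: (c01 y) => _ c1; apply: le_trans (r1 y).
  by rewrite -[leRHS]mul1e lee_wpmul2r// integral_ge0// => t _; rewrite lee_fin.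
- move=> y y' yy'.
  have [|-> ->//] := cr y y'.
  by move=> j; rewrite inE negb_or => /andP[_]; exact: yy'.
move=> y.
(* Resampling [i] changes neither [c] nor [r], which ignore the coordinates in [i :: s], nor the
   other factors, because [i] is not in [s]. *)
have FE' t : F (resample i y t) =
    (c y * (\prod_(j <- s) r y (tnth y j))%:E * (r y t)%:E)%E.
  rewrite FE.
  have [|<- <-] := cr y (resample i y t).
    by move=> j; rewrite inE negb_or tnth_mktuple => /andP[/negbTE ->].
  rewrite big_cons tnth_mktuple eqxx mulrC EFinM muleA; congr (_ * _%:E * _)%E.
  rewrite big_seq [RHS]big_seq; apply: eq_bigr => j js.
  rewrite tnth_mktuple ifN//; apply: contraNneq iNs => <-//.
under eq_integral do rewrite FE'.
rewrite ge0_integralZl//.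
- by rewrite -!muleA; congr (_ * _)%E; rewrite muleC.
- exact/measurable_EFinP.
- by move=> t _; rewrite lee_fin.
- by rewrite mule_ge0// lee_fin prodr_ge0.
Qed.

End Box.

(** * From an expectation bound to coverage *)

Lemma le1_integral_probability_ge {d} {T : measurableType d} {R : realType}
    (L : probability T R) (S : T -> \bar R) (alpha : R) :
  0 < alpha -> measurable_fun setT S -> (forall x, 0 <= S x)%E ->
  (\int[L]_x S x <= 1)%E ->
  ((1 - alpha)%:E <= L [set x | S x <= (1 / alpha)%:E])%E.
Proof.
move=> alpha0 mS S0 S1; rewrite div1r.
have mle : measurable [set x | (S x <= (alpha^-1)%:E)%E].
  by rewrite -[X in measurable X]setTI; exact: emeasurable_fun_infty_c.
have mge : measurable [set x | ((alpha^-1)%:E <= S x)%E].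
  by rewrite -[X in measurable X]setTI; exact: emeasurable_fun_c_infty.
have Lge : (L [set x | ((alpha^-1)%:E <= S x)%E] <= alpha%:E)%E.
  have absS x : `|S x|%E = S x by rewrite gee0_abs.
  have ai0 : 0 < alpha^-1 by rewrite invr_gt0.
  (* With the identity as the monotone function, this is Markov's inequality at level [alpha^-1]. *)
  have := @le_integral_comp_abse _ _ _ L setT measurableT S alpha^-1 id
    (@measurable_id _ _ _) (fun _ => id) (fun _ _ _ _ => id) mS ai0.
  under eq_integral do rewrite absS.
  under eq_set do rewrite absS.
  by rewrite setTI => /le_trans/(_ S1); rewrite lee_pdivrMl// mule1.
(* The complementary event has strict inequality, hence lies inside the event bounded by [Lge]. *)
rewrite -[X in L X]setCK probability_setC; last exact: measurableC.
rewrite EFinB leeB//; apply: le_trans Lge; apply: le_measure; rewrite ?inE//.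
  exact: measurableC.
by move=> x /= /negP; rewrite -ltNge => /ltW.
Qed.

(** * The split ratio under a product law, for a fixed split *)

Section ProductLaw.
Context {d} {T : measurableType d} {R : realType} {N : nat}.
Variables (L : probability (N.-tuple T) R) (Q : probability T R).
Hypothesis LE : forall A, (forall j, measurable (A j)) ->
  L (box A) = (\prod_j Q (A j))%E.

Lemma marginal_law i (A : set T) : measurable A ->
  L ((@tnth N T)^~ i @^-1` A) = Q A.
Proof.
move=> mA; pose B (j : 'I_N) := if j == i then A else setT.
have -> : (@tnth N T)^~ i @^-1` A = box B.
  apply/seteqP; split => [y /= Ay j|y /(_ i)]; last by rewrite /B eqxx.
  by rewrite /B; case: eqP => // ->.
rewrite LE; last by move=> j; rewrite /B; case: ifP.
rewrite (bigD1 i)//= /B eqxx big1 ?mule1// => j /negbTE ->.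
exact: probability_setT.
Qed.

Variables (mu : {measure set T -> \bar R}) (Theta : Type).
Variables (Ptheta : Theta -> probability T R) (p : Theta -> T -> R).
Hypothesis hp : forall theta, is_density mu (Ptheta theta) (p theta).
Variable theta : Theta.
Hypothesis QE : Q = Ptheta theta.

Let p0 t x : 0 <= p t x.
Proof. by have [] := hp t. Qed.

Let mp t : measurable_fun setT (p t).
Proof. by have [] := hp t. Qed.

Lemma likelihood_ge0 D (y : N.-tuple T) t : 0 <= likelihood p D y t.
Proof. by apply: prodr_ge0 => i _; exact: p0. Qed.

Lemma measurable_likelihood D t :
  measurable_fun setT (fun y : N.-tuple T => likelihood p D y t).
Proof.
under eq_fun do rewrite /likelihood -big_enum/=.
apply: measurable_prod => i _.
exact: measurableT_comp (mp t) (measurable_tnth i).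
Qed.

(** Every coordinate has law [Q], which does not charge the zeros of [p theta]; a finite union of
    null sets is null. *)
Lemma likelihood_neq0_ae D : {ae L, forall y, likelihood p D y theta != 0}.
Proof.
have : \forall y \ae L, forall i : 'I_N, p theta (tnth y i) != 0.
  apply: filter_forall => i.
  have mZ : measurable (p theta @^-1` [set 0]).
    by rewrite -[X in measurable X]setTI; exact: mp (measurable_set1 0).
  exists ((@tnth N T)^~ i @^-1` (p theta @^-1` [set 0])); split.
  - by rewrite -[X in measurable X]setTI; exact: measurable_tnth.
  - by rewrite marginal_law// QE; exact: is_density_eq0 (hp theta).
  - by move=> y /= /negP/negPn/eqP.
by apply: filterS => y py; apply/prodf_neq0 => i _.
Qed.

Variable est : {set 'I_N} -> N.-tuple T -> Theta.

Lemma split_LRE D y : split_LR p est D y theta =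
  ((likelihood p D y (est (~: D) y))%:E *
   (if likelihood p D y theta == 0%R then +oo
    else ((likelihood p D y theta)^-1)%:E))%E.
Proof. by rewrite /split_LR inver. Qed.

Lemma split_LR_ge0 D y : (0 <= split_LR p est D y theta)%E.
Proof.
rewrite split_LRE mule_ge0 ?lee_fin ?likelihood_ge0//.
by case: ifP => // _; rewrite lee_fin invr_ge0 likelihood_ge0.
Qed.

Variable D : {set 'I_N}.
Hypothesis hest : constructed_from (~: D) (est (~: D)).
Hypothesis hmeas : measurable_fun setT
  (fun y : N.-tuple T => likelihood p D y (est (~: D) y)).

Lemma measurable_split_LR :
  measurable_fun setT (fun y => split_LR p est D y theta).
Proof.
under eq_fun do rewrite split_LRE.
apply: emeasurable_funM; first exact/measurable_EFinP.
apply: measurable_fun_ifT => //.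
  by apply: measurable_fun_eqr => //; exact: measurable_likelihood.
apply/measurable_EFinP/measurable_funV; last exact: measurable_likelihood.
by move=> y; exact: likelihood_ge0.
Qed.

Lemma integral_split_LR_le1 : (\int[L]_y split_LR p est D y theta <= 1)%E.
Proof.
(* [F] uses real division, where division by 0 gives 0; it can differ from the extended-real ratio
   only on the null set where the denominator vanishes. *)
pose F y := (likelihood p D y (est (~: D) y) / likelihood p D y theta)%:E.
have mF : measurable_fun setT F.
  apply/measurable_EFinP/measurable_funM => //.
  by apply: measurable_funV => [y|];
    [exact: likelihood_ge0|exact: measurable_likelihood].
rewrite (@ge0_ae_eq_integral _ _ _ L setT _ F)//; first last.
- apply: filterS (likelihood_neq0_ae D) => y py _.
  by rewrite split_LRE (negbTE py).
- by move=> y _; rewrite lee_fin divr_ge0// likelihood_ge0.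
- by move=> y _; exact: split_LR_ge0.
- exact: measurable_split_LR.
(* Here [c] is 1 and [r y] is the density ratio at the estimate, which by [hest] is unaffected by
   the coordinates in [D]. *)
apply: (integral_prod_le1 L Q LE (enum D) F (fun=> 1%E)
  (fun y x => p (est (~: D) y) x / p theta x)) => //.
- exact: enum_uniq.
- by move=> y; rewrite lee01 lexx.
- move=> y y' yy'; split=> //; rewrite (hest y y')// => i.
  by rewrite inE => iD; apply: yy'; rewrite mem_enum.
- by move=> y x; rewrite divr_ge0.
- by move=> y; apply: measurable_funM => //; exact: measurable_funV.
- by move=> y; rewrite QE; exact: integral_density_ratio_le1 (hp _) (hp _).
- by move=> y; rewrite mul1e /F /likelihood -prodf_div big_enum.
Qed.

End ProductLaw.

(** * Law of the sample and averaging over the random split *)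

Section Sample.
Context {dO} {Omega : measurableType dO} {R : realType}.
Variables (P : probability Omega R).
Context {d} {T : measurableType d}.

Lemma measurable_sample N (Y : 'I_N -> {RV P >-> T}) :
  measurable_fun setT (sample Y).
Proof.
apply/measurable_fun_tnthP => j.
rewrite (_ : _ \o _ = Y j); first exact: measurable_funP.
by apply/funext => w; rewrite /= tnth_mktuple.
Qed.

Lemma iid_sample_box N (Y : 'I_N -> {RV P >-> T}) (Q : probability T R)
    (A : 'I_N -> set T) :
  iid_from Q Y -> (forall j, measurable (A j)) ->
  P (sample Y @^-1` box A) = (\prod_j Q (A j))%E.
Proof.
move=> [indY YQ] mA; have := indY [set: 'I_N]%SET A mA.
rewrite (_ : \bigcap_(i in _) _ = sample Y @^-1` box A).
  move=> ->; apply: eq_big => [i|i _]; first by rewrite inE.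
  exact: YQ.
apply/seteqP; split => w /= Aw j; last by have := Aw j; rewrite tnth_mktuple.
by rewrite tnth_mktuple; apply: Aw; rewrite /= inE.
Qed.

(** The events that [D0] equals [D] partition the space; by independence each contributes at least
    [c] times its probability, and these probabilities sum to 1. *)
Lemma independent_half_split_ge n (Y : 'I_(2 * n) -> {RV P >-> T})
    (D0 : Omega -> {set 'I_(2 * n)})
    (B : {set 'I_(2 * n)} -> set ((2 * n).-tuple T))
    (c : \bar R) :
  independent_half_split Y D0 -> 
    (forall D : {set 'I_(2 * n)}, #|D| = n -> measurable (B D)) ->
  (forall D : {set 'I_(2 * n)}, #|D| = n -> c <= P (sample Y @^-1` B D))%E ->
  (c <= P [set w | B (D0 w) (sample Y w)])%E.
Proof.
move=> [cD0 mD0 indD0] mB cB.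
pose H (D : {set 'I_(2 * n)}) := D0 @^-1` [set D].
(* The hypotheses on [B] cover only sets of size [n]; emptying the other values makes every term
   measurable and loses nothing, as [D0] always has size [n]. *)
pose B' (D : {set 'I_(2 * n)}) := if #|D| == n then B D else set0.
have mB' D : measurable (B' D) by rewrite /B'; case: ifP => // /eqP /mB.
have fD : finite_set [set: {set 'I_(2 * n)}] by exact: finite_finset.
have tH : trivIset [set: {set 'I_(2 * n)}] H.
  by move=> D D' _ _ [w [/= <- <-]].
have HT : (\sum_(D \in [set: {set 'I_(2 * n)}]) P (H D))%E = 1%E.
  rewrite -measure_fin_bigcup//; last by move=> D _; exact: mD0.
  rewrite -(probability_setT P); congr (P _); apply/seteqP; split => // w _.
  by exists (D0 w).
have -> : [set w | B (D0 w) (sample Y w)] =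
    \bigcup_(D in [set: {set 'I_(2 * n)}]) (H D `&` sample Y @^-1` B' D).
  apply/seteqP; split => [w /= Bw|w [D _ [/= <-]]].
    by exists (D0 w) => //; split => //=; rewrite /B' cD0 eqxx.
  by rewrite /B' cD0 eqxx.
rewrite measure_fin_bigcup//; last 2 first.
- by move=> D D' _ _ [w [[/= <- _] [/= <- _]]].
- move=> D _; apply: measurableI; first exact: mD0.
  by rewrite -[X in measurable X]setTI; exact: measurable_sample.
rewrite -[leLHS]mule1 -HT ge0_mule_fsumr//; apply: lee_fsum => // D _.
rewrite [leRHS]indD0// [leLHS]muleC /H.
have [cD|cD] := eqVneq #|D| n.
  by rewrite lee_wpmul2l// /B' cD eqxx; exact: cB.
have -> : D0 @^-1` [set D] = set0.
  by apply/seteqP; split => // w /= Dw; rewrite -Dw cD0 eqxx in cD.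
by rewrite measure0 !mul0e.
Qed.

End Sample.

(** * Coverage of the split and crossfit sets *)

Theorem theorem1 (R : realType) (alpha : R) (halpha0 : 0 < alpha)
    (halpha1 : alpha < 1)
    (d : measure_display) (T : measurableType d)
    (mu : {measure set T -> \bar R})
    (Theta : Type) (Ptheta : Theta -> probability T R) (p : Theta -> T -> R)
    (hp : forall theta, is_density mu (Ptheta theta) (p theta))
    (dO : measure_display) (Omega : measurableType dO)
    (P : probability Omega R)
    (n : nat) (Y : 'I_(2 * n) -> {RV P >-> T}) (thetastar : Theta)
    (hY : iid_from (Ptheta thetastar) Y)
    (D0 : Omega -> {set 'I_(2 * n)}) (hD0 : independent_half_split Y D0)
    (est : {set 'I_(2 * n)} -> (2 * n).-tuple T -> Theta)
    (hest : forall D : {set 'I_(2 * n)}, #|D| = n -> constructed_from D (est D))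
    (hmeas : forall D : {set 'I_(2 * n)}, #|D| = n ->
      measurable_fun setT
        (fun y : (2 * n).-tuple T => likelihood p D y (est (~: D) y))) :
  ((1 - alpha)%:E <=
     P [set w | thetastar \in split_set p est alpha (D0 w) (sample Y w)])%E /\
  ((1 - alpha)%:E <=
     P [set w | thetastar \in crossfit_set p est alpha (D0 w) (sample Y w)])%E.
Proof.
pose Ys : {mfun Omega >-> (2 * n).-tuple T} :=
  HB.pack (sample Y) (isMeasurableFun.Build _ _ _ _ _ (measurable_sample P _ Y)).
pose L : probability _ R := distribution P Ys.
have LE A : (forall j, measurable (A j)) ->
    L (box A) = (\prod_j Ptheta thetastar (A j))%E.
  exact: iid_sample_box.
(* Both halves have size [n], so every bound for [D] also holds with the roles of the halves
   swapped. *)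
have cardC (D : {set 'I_(2 * n)}) : #|D| = n -> #|~: D| = n.
  move=> cD; apply: (@addnI n).
  by rewrite -[X in (X + _)%N = _]cD cardsC card_ord mul2n -addnn.
pose S D y := split_LR p est D y thetastar.
have S0 D y : (0 <= S D y)%E by exact: split_LR_ge0 hp _ _ _ _.
have mS (D : {set 'I_(2 * n)}) : #|D| = n -> measurable_fun setT (S D).
  by move=> cD; apply: measurable_split_LR hp _ _ _ (hmeas D cD).
have S1 (D : {set 'I_(2 * n)}) : #|D| = n -> (\int[L]_y S D y <= 1)%E.
  move=> cD; apply: (integral_split_LR_le1 L (Ptheta thetastar) LE mu Theta
    Ptheta p hp) => //; last exact: hmeas.
  by apply: hest; exact: cardC.
split.
- rewrite (_ : [set w | _] = [set w | split_set p est alpha (D0 w)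
      (sample Y w) thetastar]); last by apply/seteqP; split => w /=; rewrite inE.
  apply: (independent_half_split_ge P n Y D0
    (fun D => [set y | split_set p est alpha D y thetastar])) => // D cD.
    rewrite -[X in measurable X]setTI.
    exact: emeasurable_fun_infty_c (mS D cD) _.
  exact: (le1_integral_probability_ge L (S D)) (mS D cD) (S0 D) (S1 D cD).
pose C D y := crossfit_LR p est D y thetastar.
have CE D : C D = (fun y => (2^-1)%:E * (S D y + S (~: D) y))%E.
  by apply/funext => y; rewrite /C /crossfit_LR inver pnatr_eq0/= muleC.
have C0 D y : (0 <= C D y)%E by rewrite CE mule_ge0// ?adde_ge0// lee_fin.
have mC (D : {set 'I_(2 * n)}) : #|D| = n -> measurable_fun setT (C D).
  move=> cD; rewrite CE; apply: emeasurable_funM => //.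
  by apply: emeasurable_funD; apply: mS => //; exact: cardC.
have C1 (D : {set 'I_(2 * n)}) : #|D| = n -> (\int[L]_y C D y <= 1)%E.
  move=> cD; have cD' := cardC D cD; rewrite CE ge0_integralZl_EFin//; first last.
  - by apply: emeasurable_funD; exact: mS.
  - by move=> y _; rewrite adde_ge0.
  rewrite ge0_integralD//; [|exact: mS..].
  (* Once the factor 1/2 is cleared, the bound 2 is split as 1 + 1, one unit for each of the two
     split ratios. *)
  rewrite lee_pdivrMl// mule1 (_ : 2 = 1 + 1)// EFinD.
  by apply: leeD; exact: S1.
rewrite (_ : [set w | _] = [set w | crossfit_set p est alpha (D0 w)
    (sample Y w) thetastar]); last by apply/seteqP; split => w /=; rewrite inE.
apply: (independent_half_split_ge P n Y D0
  (fun D => [set y | crossfit_set p est alpha D y thetastar])) => // D cD.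
  rewrite -[X in measurable X]setTI.
  exact: emeasurable_fun_infty_c (mC D cD) _.
exact: (le1_integral_probability_ge L (C D)) (mC D cD) (C0 D) (C1 D cD).
Qed.
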